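(* Let $M$ be a smooth $3$-manifold with a projective structure $[\nabla]$, let $W_{ab}{}^c{}_d$ be its projective Weyl tensor, let $\epsilon^{abc}$ be a nowhere-vanishing section of $\Lambda^3(TM)$ with dual $3$-form $\epsilon_{abc}$ normalised by $\epsilon^{abc}\epsilon_{abc}=6$, and put $V^{ab}{}_c=\epsilon^{dea}W_{de}{}^b{}_c$. In order that $[\nabla]$ be metrisable, the invariant scalar $$S=\epsilon_{abc}V^{ap}{}_qV^{bq}{}_rV^{cr}{}_p$$ must vanish identically, whilst in general it does not (i.e. there exist $3$-dimensional projective structures for which $S$ is not identically zero).
   Context: Abstract index notation is used; a repeated index denotes contraction, square brackets on indices denote skew-symmetrisation. A projective structure $[\nabla]$ is an equivalence class of torsion-free connections on $TM$, where $\nabla\sim\hat\nabla$ if there is a $1$-form $\Upsilon_a$ with $\hat\nabla_aX^b=\nabla_aX^b+\Upsilon_aX^b+\delta_a{}^b\Upsilon_cX^c$. It is metrisable if it contains the Levi-Civita connection of some (pseudo-)Riemannian metric. The curvature of $\nabla\in[\nabla]$ is defined by $[\nabla_a,\nabla_b]X^c=R_{ab}{}^c{}_dX^d$. It decomposes uniquely as $R_{ab}{}^c{}_d=W_{ab}{}^c{}_d+\delta_a{}^c\mathrm{P}_{bd}-\delta_b{}^c\mathrm{P}_{ad}+\beta_{ab}\delta_d{}^c$ with $\beta_{ab}=-2\mathrm{P}_{[ab]}$ and $W_{ab}{}^c{}_d$ totally trace-free; $W_{ab}{}^c{}_d$ is the projective Weyl tensor, and it depends only on $[\nabla]$. A different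 choice of $\epsilon^{abc}$ only rescales $S$ pointwise by a non-zero factor. *)

(* Defs.v *)
From HB Require Import structures.
From mathcomp Require Import all_boot all_order all_algebra.
From mathcomp Require Import all_classical all_reals all_analysis.

Set Implicit Arguments.
Unset Strict Implicit.
Unset Printing Implicit Defensive.

Import Order.TTheory GRing.Theory Num.Theory.
Import numFieldNormedType.Exports.

Local Open Scope classical_set_scope.
Local Open Scope ring_scope.

Section Calculus.
Variable R : realType.

Definition coords := 'rV[R]_3.

Definition partial (a : 'I_3) (f : coords -> R) (u : coords) : R :=
  'D_(delta_mx 0 a : coords) f u.

(* For open U this is C^oo on U: differentiability of every iterated partial
   derivative gives the continuity of all of them. *)
Definition smooth_on (U : set coords) (f : coords -> R) : Prop :=
  forall (s : seq 'I_3) (u : coords), U u ->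
    differentiable (foldr partial f s) u.

End Calculus.

Section Manifold.
Variable R : realType.

Record chart (M : topologicalType) := Chart {
  chart_dom : set M;
  chart_cod : set (coords R);
  chart_map : M -> coords R;
  chart_inv : coords R -> M;
  chart_dom_open : open chart_dom;
  chart_cod_open : open chart_cod;
  chart_map_cod : forall x, chart_dom x -> chart_cod (chart_map x);
  chart_inv_dom : forall u, chart_cod u -> chart_dom (chart_inv u);
  chart_mapK : forall x, chart_dom x -> chart_inv (chart_map x) = x;
  chart_invK : forall u, chart_cod u -> chart_map (chart_inv u) = u;
  chart_map_cont : {within chart_dom, continuous chart_map};
  chart_inv_cont : {within chart_cod, continuous chart_inv}
}.

Definition overlap (M : topologicalType) (p q : chart M) : set (coords R) :=
  [set u | chart_cod p u /\ chart_dom q (chart_inv p u)].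

Definition transition (M : topologicalType) (p q : chart M) (u : coords R) :
  coords R := chart_map q (chart_inv p u).

(* The atlas need not be maximal: any atlas determines the smooth structure. *)
Record manifold3 := Manifold3 {
  carrier :> topologicalType;
  carrier_hausdorff : hausdorff_space carrier;
  carrier_second_countable : @second_countable carrier;
  chart_ix : Type;
  charts : chart_ix -> chart carrier;
  charts_cover : forall x : carrier, exists i, chart_dom (charts i) x;
  charts_smooth : forall (i j : chart_ix) (a : 'I_3),
    smooth_on (overlap (charts i) (charts j))
      (fun u => transition (charts i) (charts j) u 0 a)
}.

End Manifold.

Section Geometry.
Variables (R : realType) (M : manifold3 R).

(* Geometric objects are given by their components in every chart.  In the
   chart i only the values at points of cod i are meaningful. *)
Definition comps (T : Type) : Type := chart_ix M -> coords R -> T.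

Definition cod (i : chart_ix M) : set (coords R) := chart_cod (charts i).

Definition ovl (i j : chart_ix M) : set (coords R) :=
  overlap (charts i) (charts j).

Definition trans (i j : chart_ix M) (u : coords R) : coords R :=
  transition (charts i) (charts j) u.

(* jac i j b a u = d y^b / d x^a at x = u, for y = trans i j x *)
Definition jac (i j : chart_ix M) (b a : 'I_3) (u : coords R) : R :=
  partial a (fun v => trans i j v 0 b) u.

Definition one_form (Y : comps ('I_3 -> R)) : Prop :=
  (forall i a, smooth_on (cod i) (fun u => Y i u a)) /\
  (forall i j u, ovl i j u -> forall a,
     Y i u a = \sum_b jac i j b a u * Y j (trans i j u) b).

(* Any signature is allowed. *)
Definition pseudo_riemannian (g : comps 'M[R]_3) : Prop :=
  [/\ forall i a b, smooth_on (cod i) (fun u => g i u a b),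
      forall i u, cod i u -> (g i u)^T = g i u,
      forall i u, cod i u -> g i u \in unitmx &
      forall i j u, ovl i j u -> forall a b,
        g i u a b = \sum_c \sum_d
          jac i j c a u * jac i j d b u * g j (trans i j u) c d].

Definition alternating (f : 'I_3 -> 'I_3 -> 'I_3 -> R) : Prop :=
  forall a b c, f b a c = - f a b c /\ f a c b = - f a b c.

Definition nonvanishing_trivector
    (eps : comps ('I_3 -> 'I_3 -> 'I_3 -> R)) : Prop :=
  [/\ forall i a b c, smooth_on (cod i) (fun u => eps i u a b c),
      forall i u, cod i u -> alternating (eps i u),
      forall i u, cod i u -> exists a b c, eps i u a b c != 0 &
      forall i j u, ovl i j u -> forall a b c,
        eps j (trans i j u) a b c = \sum_d \sum_e \sum_f
          jac i j a d u * jac i j b e u * jac i j c f u * eps i u d e f].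

(* These conditions determine epsd pointwise, so smoothness and the
   transformation law of a 3-form follow from those of eps. *)
Definition dual_form (eps epsd : comps ('I_3 -> 'I_3 -> 'I_3 -> R)) : Prop :=
  forall i u, cod i u -> alternating (epsd i u) /\
    \sum_a \sum_b \sum_c eps i u a b c * epsd i u a b c = 6.

(* G a b c is the symbol in nabla_a X^b = d_a X^b + G a b c X^c. *)
Definition conn : Type := comps ('I_3 -> 'I_3 -> 'I_3 -> R).

Definition is_connection (N : conn) : Prop :=
  (forall i a b c, smooth_on (cod i) (fun u => N i u a b c)) /\
  (forall i j u, ovl i j u -> forall a b c,
     \sum_e jac i j c e u * N i u a e b =
     \sum_d \sum_e jac i j d a u * jac i j e b u * N j (trans i j u) d c e
     + partial a (jac i j c b) u).

Definition torsion_free (N : conn) : Prop :=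
  forall i u, cod i u -> forall a b c, N i u a b c = N i u c b a.

(* Vector fields are local, defined on the domain of the chart i. *)
Definition vector_field (i : chart_ix M) (X : coords R -> 'I_3 -> R) : Prop :=
  forall b, smooth_on (cod i) (fun u => X u b).

(* nabla_a X^b *)
Definition cov_vector (G : coords R -> 'I_3 -> 'I_3 -> 'I_3 -> R)
    (X : coords R -> 'I_3 -> R) (u : coords R) (a b : 'I_3) : R :=
  partial a (fun v => X v b) u + \sum_c G u a b c * X u c.

(* nabla_a T_b^c, for T u b c = T_b^c *)
Definition cov_mixed (G : coords R -> 'I_3 -> 'I_3 -> 'I_3 -> R)
    (T : coords R -> 'I_3 -> 'I_3 -> R) (u : coords R) (a b c : 'I_3) : R :=
  partial a (fun v => T v b c) u
  - \sum_e G u a e b * T u e c + \sum_e G u a c e * T u b e.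

(* nabla_a g_bc *)
Definition cov_metric (G : coords R -> 'I_3 -> 'I_3 -> 'I_3 -> R)
    (g : coords R -> 'M[R]_3) (u : coords R) (a b c : 'I_3) : R :=
  partial a (fun v => g v b c) u
  - \sum_e G u a e b * g u e c - \sum_e G u a e c * g u b e.

Definition levi_civita (g : comps 'M[R]_3) (N : conn) : Prop :=
  [/\ is_connection N, torsion_free N &
      forall i u, cod i u -> forall a b c, cov_metric (N i) (g i) u a b c = 0].

Definition proj_equiv (N N' : conn) : Prop :=
  exists2 Y : comps ('I_3 -> R), one_form Y &
    forall i X, vector_field i X -> forall u, cod i u -> forall a b,
      cov_vector (N' i) X u a b =
      cov_vector (N i) X u a b + Y i u a * X u b
      + (a == b)%:R * \sum_c Y i u c * X u c.

Definition projective_structure (C : set conn) : Prop :=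
  exists N, [/\ is_connection N, torsion_free N &
    C = [set N' | [/\ is_connection N', torsion_free N' & proj_equiv N N']]].

Definition metrisable (C : set conn) : Prop :=
  exists2 g : comps 'M[R]_3, pseudo_riemannian g &
    exists2 N, C N & levi_civita g N.

(* (nabla_a nabla_b - nabla_b nabla_a) X^c = R_ab^c_d X^d,
   with Rm i u a b c d = R_ab^c_d *)
Definition curvature (N : conn)
    (Rm : comps ('I_3 -> 'I_3 -> 'I_3 -> 'I_3 -> R)) : Prop :=
  forall i X, vector_field i X -> forall u, cod i u -> forall a b c,
    cov_mixed (N i) (cov_vector (N i) X) u a b c
    - cov_mixed (N i) (cov_vector (N i) X) u b a c
    = \sum_d Rm i u a b c d * X u d.

Definition totally_trace_free
    (W : 'I_3 -> 'I_3 -> 'I_3 -> 'I_3 -> R) : Prop :=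
  forall p q, [/\ \sum_a W a p a q = 0, \sum_a W p a a q = 0 &
                  \sum_a W p q a a = 0].

Definition weyl_part (Rm W : 'I_3 -> 'I_3 -> 'I_3 -> 'I_3 -> R) : Prop :=
  totally_trace_free W /\
  exists P beta : 'I_3 -> 'I_3 -> R,
    (forall a b, beta a b = - 2 * ((P a b - P b a) / 2)) /\
    (forall a b c d, Rm a b c d =
       W a b c d + (a == c)%:R * P b d - (b == c)%:R * P a d
       + beta a b * (d == c)%:R).

(* The choice of the representative N does not affect W. *)
Definition weyl_tensor (C : set conn)
    (W : comps ('I_3 -> 'I_3 -> 'I_3 -> 'I_3 -> R)) : Prop :=
  exists2 N, C N & exists2 Rm, curvature N Rm &
    forall i u, cod i u -> weyl_part (Rm i u) (W i u).

(* Vtensor eps W i u a b c = V^{ab}_c *)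
Definition Vtensor (eps : comps ('I_3 -> 'I_3 -> 'I_3 -> R))
    (W : comps ('I_3 -> 'I_3 -> 'I_3 -> 'I_3 -> R)) :
    comps ('I_3 -> 'I_3 -> 'I_3 -> R) := fun i u a b c =>
  \sum_d \sum_e eps i u d e a * W i u d e b c.

Definition Sscalar (eps epsd : comps ('I_3 -> 'I_3 -> 'I_3 -> R))
    (W : comps ('I_3 -> 'I_3 -> 'I_3 -> 'I_3 -> R)) : comps R := fun i u =>
  let V := Vtensor eps W i u in
  \sum_a \sum_b \sum_c \sum_p \sum_q \sum_r
    epsd i u a b c * V a p q * V b q r * V c r p.

Definition vanishes_identically (f : comps R) : Prop :=
  forall i u, cod i u -> f i u = 0.

End Geometry.

(* Main.v *)
Require Import Defs.
From mathcomp Require Import all_boot all_order all_algebra.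
From mathcomp Require Import all_classical all_reals all_analysis.
From mathcomp Require Import ring.

Set Implicit Arguments.
Unset Strict Implicit.
Unset Printing Implicit Defensive.

Import Order.TTheory GRing.Theory Num.Theory.
Import numFieldNormedType.Exports.

Local Open Scope classical_set_scope.
Local Open Scope ring_scope.

(** Why a metric forces S = 0.  Changing the connection within its projective
    class alters the curvature only by delta-terms in a tensor P
    ([riemann_projective]), so W may be computed from the curvature of the
    Levi-Civita connection of g.  That curvature, lowered with g, is skew in
    each pair of indices ([metric_skew]) and satisfies the Bianchi identity; in
    dimension three such a tensor is the double dual of a symmetric matrix H
    ([riemann_dual]).  Removing traces then gives
      V^{ab}_c = eps_{mcq} (K^{bm} H^{aq} + K^{am} H^{bq}),   K = g^{-1}
    ([metric_weyl_dual]): contracted twice with a covector x, V is twice the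
    cross product of Kx and Hx up to sign.

    It remains to see that S vanishes on every such V ([cubic_pencil]).  This
    is a polynomial identity in the entries of K and H, and a change of basis only
    rescales S, so it is enough to know it when K and H are both diagonal: over
    an algebraically closed field the pairs that can be diagonalised
    simultaneously are dense.  For diagonal K and H only the V^{ab}_c with
    a, b, c distinct survive, and S is a multiple of
      V^{01}_2 V^{12}_0 V^{20}_1 - V^{02}_1 V^{21}_0 V^{10}_2,
    and the two products agree because V is symmetric in its upper indices.
    The proof below expands the polynomial directly.

    The analytic input is that second partial derivatives commute
    ([derive_symm]).  It enters twice: in the Ricci identity, which expresses
    the curvature tensor in terms of the symbols, and in differentiating
    nabla g = 0 once more to obtain the skew-symmetry of the lowered curvature.

    Why S need not vanish.  Seek V whose matrices V^0, V^1, V^2 are multiples of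
    the elementary matrices E_{01}, E_{12}, E_{20}: then V^0 V^1 V^2 has
    non-zero trace and V^0 V^2 V^1 = 0.  On R^3 the connection whose only symbols
    are Gamma_{b+1}^b_{b+1} = - x_{b+2} (indices mod 3) has totally trace-free
    curvature, hence W is the whole curvature, and at the origin V has this
    form, with S = 24. *)

(** * Indices in dimension three *)

Definition i0 : 'I_3 := @Ordinal 3 0 isT.
Definition i1 : 'I_3 := @Ordinal 3 1 isT.
Definition i2 : 'I_3 := @Ordinal 3 2 isT.

Lemma ord3_ind (P : 'I_3 -> Prop) : P i0 -> P i1 -> P i2 -> forall i, P i.
Proof.
move=> P0 P1 P2 [[|[|[|k]]] hk] //.
- by have <- : i0 = Ordinal hk by exact: val_inj.
- by have <- : i1 = Ordinal hk by exact: val_inj.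
- by have <- : i2 = Ordinal hk by exact: val_inj.
Qed.

Lemma sum3 (V : nmodType) (F : 'I_3 -> V) : \sum_i F i = F i0 + F i1 + F i2.
Proof.
rewrite !big_ord_recl big_ord0 addr0 addrA.
by congr (F _ + F _ + F _); exact: val_inj.
Qed.

Definition succ3 (a : 'I_3) : 'I_3 :=
  match val a with O => i1 | S O => i2 | _ => i0 end.

(** * The cubic invariant *)

Section Cubic.
Variable R : comNzRingType.

Definition eps3 (a b c : 'I_3) : R :=
  match val a, val b, val c with
  | O, S O, S (S O) | S O, S (S O), O | S (S O), O, S O => 1
  | O, S (S O), S O | S O, O, S (S O) | S (S O), S O, O => - 1
  | _, _, _ => 0
  end.

(** S for the constant trivector [eps3]; rescaling the trivector rescales S. *)
Definition cubic (V : 'I_3 -> 'I_3 -> 'I_3 -> R) : R :=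
  \sum_a \sum_b \sum_c \sum_p \sum_q \sum_r
    eps3 a b c * V a p q * V b q r * V c r p.

(** In terms of the matrices V^a, the cubic is 3 tr (V^0 [V^1, V^2]): the trace
    is cyclic, so the six signed terms fall into two groups of three. *)
Lemma cubic_trace (V : 'I_3 -> 'I_3 -> 'I_3 -> R) :
  cubic V = 3 * (\sum_p \sum_q \sum_r
    V i0 p q * (V i1 q r * V i2 r p - V i2 q r * V i1 r p)).
Proof.
rewrite /cubic !sum3 /eps3 /=; ring.
Qed.

(** This holds for diagonal K and H, where the two products
    V^{01}_2 V^{12}_0 V^{20}_1 and V^{02}_1 V^{21}_0 V^{10}_2 that make up the
    cubic coincide; a generic pair of quadratic forms is diagonal in a suitable
    basis, and a change of basis only rescales the cubic.  Over an arbitrary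
    ring it is an identity of polynomials. *)
Lemma cubic_pencil (K H : 'I_3 -> 'I_3 -> R) (V : 'I_3 -> 'I_3 -> 'I_3 -> R) :
  (forall a b, K a b = K b a) -> (forall a b, H a b = H b a) ->
  (forall a b c, V a b c =
     \sum_m \sum_q eps3 m c q * (K b m * H a q + K a m * H b q)) ->
  cubic V = 0.
Proof.
move=> KC HC VE; rewrite cubic_trace.
rewrite !sum3 !VE !sum3 /eps3 /=.
rewrite !(KC i1 i0) !(KC i2 i0) !(KC i2 i1) !(HC i1 i0) !(HC i2 i0) !(HC i2 i1).
ring.
Qed.
End Cubic.

(** * Curvature tensors in dimension three *)

Section Dual.
Variable R : numFieldType.
Implicit Types F : 'I_3 -> 'I_3 -> R.

Lemma eq_opp0 (x : R) : x = - x -> x = 0.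
Proof.
by move/eqP; rewrite -subr_eq0 opprK -mulr2n mulrn_eq0 => /eqP.
Qed.

Lemma skew_diag F : (forall a b, F a b = - F b a) -> forall a, F a a = 0.
Proof. by move=> FN a; exact/eq_opp0/FN. Qed.

Definition dual2 F (p : 'I_3) : R := F (succ3 p) (succ3 (succ3 p)).

Lemma skew_dual F : (forall a b, F a b = - F b a) ->
  forall a b, F a b = \sum_p eps3 R a b p * dual2 F p.
Proof.
move=> FN; have F0 := skew_diag FN.
by elim/ord3_ind; elim/ord3_ind; rewrite sum3 /dual2 /succ3 /eps3 /= ?F0 1?FN; ring.
Qed.

Lemma sum_delta (a : 'I_3) (F : 'I_3 -> R) : \sum_c (a == c)%:R * F c = F a.
Proof.
rewrite (bigD1 a) //= eqxx mul1r big1 ?addr0 // => c /negPf.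
by rewrite eq_sym => ->; rewrite mul0r.
Qed.

Lemma trace_delta : \sum_(c : 'I_3) (c == c)%:R = 3 :> R.
Proof. by rewrite sum3 -!natrD. Qed.

(** Dualise each skew pair; the Bianchi identity is exactly the symmetry of the
    resulting matrix. *)
Lemma riemann_dual (L : 'I_3 -> 'I_3 -> 'I_3 -> 'I_3 -> R) :
  (forall a b m d, L a b m d = - L b a m d) ->
  (forall a b m d, L a b m d = - L a b d m) ->
  (forall a b m d, L a b m d + L b d m a + L d a m b = 0) ->
  exists2 H : 'I_3 -> 'I_3 -> R, (forall p q, H p q = H q p) &
    forall a b m d, L a b m d = \sum_p \sum_q eps3 R a b p * eps3 R m d q * H p q.
Proof.
move=> L1 L2 LB.
pose H p q := dual2 (fun a b => dual2 (L a b) q) p.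
have HE a b m d : L a b m d = \sum_p \sum_q eps3 R a b p * eps3 R m d q * H p q.
  rewrite (skew_dual (L2 a b)).
  under eq_bigr => q _ do
    rewrite (skew_dual (F := fun a b => dual2 (L a b) q) (fun a b => L1 a b _ _))
      mulr_sumr.
  by rewrite exchange_big; do 2!apply: eq_bigr => ? _; rewrite mulrCA mulrA.
exists H => //.
move: (LB i0 i1 i0 i2) (LB i0 i1 i1 i2) (LB i0 i1 i2 i2).
rewrite !HE !sum3 /eps3 /= => h1 h2 h3.
have e1 : H i1 i2 = H i2 i1 by apply/eqP; rewrite -subr_eq0 -{}h1; apply/eqP; ring.
have e2 : H i2 i0 = H i0 i2 by apply/eqP; rewrite -subr_eq0 -{}h2; apply/eqP; ring.
have e3 : H i0 i1 = H i1 i0 by apply/eqP; rewrite -subr_eq0 -{}h3; apply/eqP; ring.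
by do 2!elim/ord3_ind.
Qed.

(** The trace of the decomposition over c = d makes Q symmetric, the trace over
    a = c makes 2 Q the Ricci tensor.  Writing T for the dual of the curvature
    in its first pair, the trace correction changes 2 T^{ab}_c into
    T^{ab}_c + T^{ba}_c, which is the stated form. *)
Lemma metric_weyl_dual (K : 'I_3 -> 'I_3 -> R)
    (L W : 'I_3 -> 'I_3 -> 'I_3 -> 'I_3 -> R) Q :
  (forall a b, K a b = K b a) ->
  (forall a b m d, L a b m d = - L b a m d) ->
  (forall a b m d, L a b m d = - L a b d m) ->
  (forall a b m d, L a b m d + L b d m a + L d a m b = 0) ->
  (forall p q, \sum_a W a p a q = 0) -> (forall p q, \sum_a W p q a a = 0) ->
  (forall a b c d, \sum_m K c m * L a b m d = W a b c d + (a == c)%:R * Q b d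
     - (b == c)%:R * Q a d - (Q a b - Q b a) * (d == c)%:R) ->
  exists2 H : 'I_3 -> 'I_3 -> R, (forall p q, H p q = H q p) &
    forall a b c, \sum_d \sum_e eps3 R d e a * W d e b c =
      \sum_m \sum_q eps3 R m c q * (K b m * H a q + K a m * H b q).
Proof.
move=> KC L1 L2 LB W1 W2 WE.
have QC a b : Q a b = Q b a.
  have h : \sum_c \sum_m K c m * L a b m c = 0.
    apply: eq_opp0; rewrite {1}exchange_big -sumrN; apply: eq_bigr => c _.
    rewrite -sumrN; apply: eq_bigr => m _.
    by rewrite KC L2 mulrN.
  have : \sum_c \sum_m K c m * L a b m c = 4 * (Q b a - Q a b).
    under eq_bigr => c _ do rewrite WE.
    rewrite !(sumrB, big_split) /= W2 -mulr_sumr.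
    by rewrite !sum_delta trace_delta; ring.
  by rewrite h => /esym/eqP; rewrite mulf_eq0 pnatr_eq0 /= subr_eq0 => /eqP.
have QE b d : 2 * Q b d = \sum_a \sum_m K a m * L a b m d.
  under eq_bigr => c _ do rewrite WE (QC c b) subrr mul0r subr0.
  rewrite !(sumrB, big_split) /= W1.
  by rewrite sum_delta -mulr_suml trace_delta; ring.
have [H HC LE] := riemann_dual L1 L2 LB.
pose T p b c := \sum_m \sum_q eps3 R m c q * (K b m * H p q).
have RT d e b c : \sum_m K b m * L d e m c = \sum_p eps3 R d e p * T p b c.
  under eq_bigr => m _ do rewrite LE mulr_sumr.
  rewrite exchange_big; apply: eq_bigr => p _.
  rewrite mulr_sumr; apply: eq_bigr => m _; rewrite !mulr_sumr.
  by apply: eq_bigr => q _; ring.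
exists H => // a b c.
have -> : \sum_m \sum_q eps3 R m c q * (K b m * H a q + K a m * H b q) =
    T a b c + T b a c.
  rewrite -big_split; apply: eq_bigr => m _; rewrite -big_split.
  by apply: eq_bigr => q _; rewrite mulrDr.
have QT e : Q e c = (\sum_n \sum_p eps3 R n e p * T p n c) / 2.
  by rewrite -(eq_bigr _ (fun n _ => RT n e n c)) -QE mulrAC mulfV ?mul1r ?pnatr_eq0.
have WT d e : W d e b c =
    \sum_p eps3 R d e p * T p b c - (d == b)%:R * Q e c + (e == b)%:R * Q d c.
  by rewrite -RT WE (QC d e); ring.
under eq_bigr => x _ do under eq_bigr => y _ do rewrite WT.
rewrite !sum3 !QT !sum3.
clear -T; move: T a b c => T; elim/ord3_ind; elim/ord3_ind => c; rewrite /eps3 /=.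
all: by field; rewrite ?pnatr_eq0.
Qed.
End Dual.

(** * Curvature as an algebraic expression in a jet *)

Section Pointwise.
Variable R : numFieldType.
Implicit Types (G : 'I_3 -> 'I_3 -> 'I_3 -> R).
Implicit Types (dG : 'I_3 -> 'I_3 -> 'I_3 -> 'I_3 -> R).

(** The curvature R_ab^c_d of torsion-free symbols G a b c = Gamma_a^b_c with
    dG a b c d in place of d_a Gamma_b^c_d.  Here and below dG, dX, ddX, ddg, dY
    stand for partial derivatives at one point, derivative indices first, so that
    the algebra of the curvature identities is separated from the calculus. *)
Definition riemann dG G a b c d : R := dG a b c d - dG b a c d
  + \sum_e (G a c e * G b e d - G b c e * G a e d).

Lemma riemann_skew dG G a b c d : riemann dG G a b c d = - riemann dG G b a c d.
Proof. by rewrite /riemann !sum3; ring. Qed.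

(** First Bianchi identity, from the symmetry of the symbols. *)
Lemma riemann_bianchi dG G :
  (forall a b c, G a b c = G c b a) -> (forall a b c d, dG a b c d = dG a d c b) ->
  forall a b c d,
  riemann dG G a b c d + riemann dG G b d c a + riemann dG G d a c b = 0.
Proof.
move=> GC dGC a b c d; rewrite /riemann !sum3.
rewrite !(GC d _ a) !(GC d _ b) !(GC b _ a) (dGC a d) (dGC b d) (dGC b a) (dGC d b) //.
by rewrite (dGC a b) (dGC b d) (dGC d a); ring.
Qed.

Lemma ricci_algebra dG G (X : 'I_3 -> R)
    (dX : 'I_3 -> 'I_3 -> R) (ddX : 'I_3 -> 'I_3 -> 'I_3 -> R) :
  (forall a b c, G a b c = G c b a) -> (forall a b c, ddX a b c = ddX b a c) ->
  let cov b c := dX b c + \sum_d G b c d * X d in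
  let cov2 a b c := ddX a b c + \sum_d (dG a b c d * X d + G b c d * dX a d)
    - \sum_e G a e b * cov e c + \sum_e G a c e * cov b e in
  forall a b c, cov2 a b c - cov2 b a c = \sum_d riemann dG G a b c d * X d.
Proof.
move=> GC ddXC cov cov2 a b c; rewrite /cov2 (ddXC b a).
under [X in - X]eq_bigr => e _ do rewrite GC.
under [X in _ - (_ - X + _)]eq_bigr => e _ do rewrite GC.
rewrite /cov /riemann !sum3 !(GC b _ a); ring.
Qed.

(** Skewing the derivative of dg = G g + G g in the two derivative indices
    kills the left-hand side; substituting dg again on the right leaves
    R_ab^e_c g_ed + R_ab^e_d g_ce. *)
Lemma metric_algebra dG G (g : 'I_3 -> 'I_3 -> R)
    (ddg : 'I_3 -> 'I_3 -> 'I_3 -> 'I_3 -> R) :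
  (forall a b c d, ddg a b c d = ddg b a c d) ->
  let dg a b c := \sum_e G a e b * g e c + \sum_e G a e c * g b e in
  (forall a b c d, ddg a b c d =
     \sum_e (dG a b e c * g e d + G b e c * dg a e d) +
     \sum_e (dG a b e d * g c e + G b e d * dg a c e)) ->
  forall a b c d,
    \sum_e (riemann dG G a b e c * g e d + riemann dG G a b e d * g c e) = 0.
Proof.
move=> ddgC dg ddgE a b c d.
transitivity (ddg a b c d - ddg b a c d); last by rewrite (ddgC b) subrr.
rewrite !ddgE /dg /riemann !sum3; ring.
Qed.

(** A projective change of symbols shifts the curvature by terms of the shape
    that defines the Weyl part, with P_bd = - nabla_b Y_d + Y_b Y_d. *)
Lemma projective_algebra dG G (Y : 'I_3 -> R) (dY : 'I_3 -> 'I_3 -> R) :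
  (forall a b c, G a b c = G c b a) ->
  let P b d := - dY b d + \sum_e Y e * G b e d + Y b * Y d in
  forall a b c d,
  riemann (fun a b c d => dG a b c d + dY a b * (c == d)%:R + (b == c)%:R * dY a d)
    (fun a b c => G a b c + Y a * (b == c)%:R + (a == b)%:R * Y c) a b c d =
  riemann dG G a b c d + (a == c)%:R * P b d - (b == c)%:R * P a d
    - (P a b - P b a) * (d == c)%:R.
Proof.
move=> GC P.
have prodE a b c d : \sum_e ((G a c e + Y a * (c == e)%:R + (a == c)%:R * Y e) *
      (G b e d + Y b * (e == d)%:R + (b == e)%:R * Y d)) =
    \sum_e G a c e * G b e d + G a c d * Y b + G a c b * Y d + Y a * G b c d
    + Y a * Y b * (c == d)%:R + Y a * Y d * (b == c)%:R
    + (a == c)%:R * (\sum_e Y e * G b e d + 2 * Y b * Y d).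
  transitivity (\sum_e G a c e * G b e d
     + \sum_e (d == e)%:R * (G a c e * Y b) + \sum_e (b == e)%:R * (G a c e * Y d)
     + \sum_e (c == e)%:R *
         (Y a * (G b e d + Y b * (e == d)%:R + (b == e)%:R * Y d))
     + (a == c)%:R * (\sum_e Y e * G b e d + \sum_e (d == e)%:R * (Y e * Y b)
                      + \sum_e (b == e)%:R * (Y e * Y d))).
    rewrite -!big_split mulr_sumr -big_split; apply: eq_bigr => e _ /=.
    by rewrite (eq_sym d e); ring.
  by rewrite !sum_delta; ring.
move=> a b c d; rewrite /riemann !sumrB !prodE /P (eq_sym d c).
have -> : \sum_e Y e * G b e a = \sum_e Y e * G a e b.
  by apply: eq_bigr => e _; rewrite GC.
by rewrite (GC b c a); ring.
Qed.
End Pointwise.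

(** * Vanishing of the scalar at a point *)

Section PointwiseScalar.
Variable R : realType.

Lemma alternating_eps3 (f : 'I_3 -> 'I_3 -> 'I_3 -> R) : Defs.alternating f ->
  forall a b c, f a b c = f i0 i1 i2 * eps3 R a b c.
Proof.
move=> fA.
have f1 a b c : f b a c = - f a b c by have [] := fA a b c.
have f2 a b c : f a c b = - f a b c by have [] := fA a b c.
have faac a c : f a a c = 0 by exact: eq_opp0 (f1 _ _ _).
have fcaa a c : f c a a = 0 by exact: eq_opp0 (f2 _ _ _).
have faca a c : f a c a = 0 by rewrite f2 faac oppr0.
do 3!elim/ord3_ind; rewrite /eps3 /= ?faac ?fcaa ?faca ?mulr0 ?mulr1 ?mulrN1 //.
- by rewrite f2 f1 opprK.
- by rewrite f1 f2 opprK.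
- by rewrite f1 f2 f1 opprK.
Qed.

(** Lowering an index with g and raising it again with K = g^-1 puts the
    hypotheses into the form of [metric_weyl_dual]; both trivectors are
    multiples of [eps3]. *)
Lemma metric_scalar_vanishes (g : 'M[R]_3)
    (Rm W : 'I_3 -> 'I_3 -> 'I_3 -> 'I_3 -> R)
    (Q : 'I_3 -> 'I_3 -> R) (eps epsd : 'I_3 -> 'I_3 -> 'I_3 -> R) :
  g^T = g -> g \in unitmx ->
  (forall a b c d, Rm a b c d = - Rm b a c d) ->
  (forall a b c d, Rm a b c d + Rm b d c a + Rm d a c b = 0) ->
  (forall a b c d, \sum_e (Rm a b e c * g e d + Rm a b e d * g c e) = 0) ->
  totally_trace_free W ->
  (forall a b c d, Rm a b c d = W a b c d + (a == c)%:R * Q b d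
     - (b == c)%:R * Q a d - (Q a b - Q b a) * (d == c)%:R) ->
  Defs.alternating eps -> Defs.alternating epsd ->
  let V a b c := \sum_d \sum_e eps d e a * W d e b c in
  \sum_a \sum_b \sum_c \sum_p \sum_q \sum_r
    epsd a b c * V a p q * V b q r * V c r p = 0.
Proof.
move=> gT gU Rskew Rbianchi Rmetric Wtf RmE epsA epsdA V.
have gC a b : g a b = g b a by rewrite -{1}gT mxE.
pose K c m := invmx g c m.
have KC c m : K c m = K m c by rewrite /K -{1}gT -trmx_inv mxE.
pose L a b m d := \sum_e g m e * Rm a b e d.
have LK a b c d : \sum_m K c m * L a b m d = Rm a b c d.
  rewrite /L; under eq_bigr => m _ do rewrite mulr_sumr.
  rewrite exchange_big /= -[RHS](sum_delta c (fun e => Rm a b e d)).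
  apply: eq_bigr => e _.
  have <- : (invmx g *m g) c e = (c == e)%:R by rewrite mulVmx// mxE.
  by rewrite mxE mulr_suml; apply: eq_bigr => m _; rewrite mulrA.
have L1 a b m d : L a b m d = - L b a m d.
  by rewrite -sumrN; apply: eq_bigr => e _; rewrite Rskew mulrN.
have L2 a b m d : L a b m d = - L a b d m.
  apply/eqP; rewrite -addr_eq0 -big_split /=; apply/eqP.
  apply: etrans (Rmetric a b m d); apply: eq_bigr => e _ /=.
  by rewrite addrC (mulrC (g d e)) (gC d e) (mulrC (g m e)).
have LB a b m d : L a b m d + L b d m a + L d a m b = 0.
  rewrite -!big_split big1// => e _ /=.
  by rewrite -!mulrDr Rbianchi mulr0.
have W1 p q : \sum_a W a p a q = 0 by have [] := Wtf p q.
have W3 p q : \sum_a W p q a a = 0 by have [] := Wtf p q.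
have [H HC VE] := metric_weyl_dual KC L1 L2 LB W1 W3
  (fun a b c d => etrans (LK a b c d) (RmE a b c d)).
pose V0 a b c := \sum_d \sum_e eps3 R d e a * W d e b c.
have VV a b c : V a b c = eps i0 i1 i2 * V0 a b c.
  rewrite /V /V0 mulr_sumr; apply: eq_bigr => d _; rewrite mulr_sumr.
  by apply: eq_bigr => e _; rewrite (alternating_eps3 epsA) mulrA.
transitivity (epsd i0 i1 i2 * eps i0 i1 i2 ^+ 3 * cubic V0); last first.
  by rewrite (cubic_pencil KC HC VE) mulr0.
rewrite /cubic; do 6![rewrite [RHS]mulr_sumr; apply: eq_bigr => ? _].
by rewrite (alternating_eps3 epsdA) !VV; ring.
Qed.
End PointwiseScalar.

(** * Symmetry of second derivatives *)

Lemma eq_common_approx (R : realFieldType) (A B : R) :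
  (forall e, 0 < e -> exists2 X, `|A - X| < e & `|B - X| < e) -> A = B.
Proof.
move=> AB; apply/eqP; rewrite -subr_eq0 -normr_le0; apply/ler_addgt0Pr => e e0.
have [X AX BX] := AB (e / 2) ltac:(by rewrite divr_gt0).
rewrite add0r (splitr e) (le_trans (ler_distD X A B))//.
by rewrite lerD// ?(distrC X) ltW.
Qed.

Section Schwarz.
Variables (R : realType) (V : normedModType R).
Implicit Types (f : V -> R) (u v w x : V).

Lemma derive_line f x v (s : R) : derivable f (s *: v + x) v ->
  is_derive s 1 (fun t => f (t *: v + x)) ('D_v f (s *: v + x)).
Proof.
move=> fd.
have E : (fun h : R => h^-1 *: (f ((h *: 1 + s) *: v + x) - f (s *: v + x)))
  = (fun h : R => h^-1 *: (f (h *: v + (s *: v + x)) - f (s *: v + x))).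
  by apply/funext => h; rewrite [h *: 1]mulr1 scalerDl addrA.
apply: DeriveDef; first by rewrite /derivable/= E.
by rewrite /derive /= E.
Qed.

Lemma MVT_line f x v (h : R) : 0 < h ->
  (forall s, 0 <= s <= h -> derivable f (s *: v + x) v) ->
  exists2 s, 0 <= s <= h & f (h *: v + x) - f x = h * 'D_v f (s *: v + x).
Proof.
move=> h0 fd.
have fdI s : s \in `[0, h] ->
    is_derive s 1 (fun t => f (t *: v + x)) ('D_v f (s *: v + x)).
  by rewrite in_itv/= => /fd; exact: derive_line.
pose F s := f (s *: v + x); pose dF s := 'D_v f (s *: v + x).
have Fc : {within `[0, h], continuous F}.
  by apply: derivable_within_continuous => s /fdI [].
have [s sI] := @MVT R F dF 0 h h0 (fun s sI => fdI s (subset_itv_oo_cc sI)) Fc.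
rewrite /F /dF scale0r add0r subr0 mulrC => E; exists s => //.
by move/subset_itv_oo_cc: sI; rewrite in_itv.
Qed.

Lemma derive_shift_arg f c x v : 'D_v (fun y => f (y + c)) x = 'D_v f (x + c).
Proof. by rewrite /derive; under eq_fun => h do rewrite /= -addrA. Qed.

Lemma derivable_shift_arg f c x v :
  derivable f (x + c) v -> derivable (fun y => f (y + c)) x v.
Proof.
by rewrite /derivable; under [in X in _ -> X]eq_fun => h do rewrite /= -addrA.
Qed.

(** Two applications of the mean value theorem: in the direction v to the
    increment of f along w, then in the direction w to 'D_v f. *)
Lemma second_difference f u v w (h : R) : 0 < h ->
  (forall s t, 0 <= s <= h -> 0 <= t <= h ->
    derivable f (s *: v + (t *: w + u)) v /\
    derivable ('D_v f) (s *: v + (t *: w + u)) w) ->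
  exists s t, [/\ 0 <= s <= h, 0 <= t <= h &
    f (h *: v + (h *: w + u)) - f (h *: v + u) - f (h *: w + u) + f u =
    h ^+ 2 * 'D_w ('D_v f) (s *: v + (t *: w + u))].
Proof.
move=> h0 fd.
have hh : 0 <= h <= h by rewrite lexx ltW.
have oh : (0 : R) <= 0 <= h by rewrite lexx ltW.
pose F y := f (y + h *: w) - f y.
have shiftE s t : s *: v + (t *: w + u) = s *: v + u + t *: w.
  by rewrite addrCA addrC.
have dv s t : 0 <= s <= h -> 0 <= t <= h -> derivable f (s *: v + u + t *: w) v.
  by move=> sh th; rewrite -shiftE; exact: (fd _ _ sh th).1.
have d0 s : 0 <= s <= h -> derivable f (s *: v + u) v.
  by move=> sh; rewrite -[_ + u](addr0 _) -(scale0r w); exact: dv.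
have [s sh Es] : exists2 s, 0 <= s <= h &
    F (h *: v + u) - F u = h * 'D_v F (s *: v + u).
  apply: MVT_line; [exact: h0|move=> s sh; apply: derivableB; last exact: d0].
  by apply: derivable_shift_arg; exact: dv.
have [t th Et] := @MVT_line ('D_v f) (s *: v + u) w h h0
  (fun t th => ltac:(rewrite addrCA; exact: (fd _ _ sh th).2)).
exists s, t; split; [exact: sh|exact: th|].
have DF : 'D_v F (s *: v + u) = 'D_v f (h *: w + (s *: v + u)) - 'D_v f (s *: v + u).
  rewrite deriveB; [|by apply: derivable_shift_arg; apply: dv|exact: d0].
  by rewrite derive_shift_arg [_ + h *: w]addrC.
transitivity (F (h *: v + u) - F u); first by rewrite /F shiftE [u + _]addrC; ring.
rewrite Es DF Et [s *: v + (t *: w + u)]addrCA expr2.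
exact: mulrA.
Qed.

(** The second difference quotient is symmetric in v and w, and by
    [second_difference] it is a value, at a point close to u, of either mixed
    derivative. *)
Lemma derive_symm f (U : set V) u v w : open U -> U u ->
  (forall x, U x -> [/\ derivable f x v, derivable f x w,
     derivable ('D_v f) x w & derivable ('D_w f) x v]) ->
  {for u, continuous ('D_w ('D_v f))} -> {for u, continuous ('D_v ('D_w f))} ->
  'D_w ('D_v f) u = 'D_v ('D_w f) u.
Proof.
move=> Uo Uu fd c1 c2.
apply: eq_common_approx => e e0.
have [r r0 rP] : exists2 r : R, 0 < r & forall x, `|u - x| < r ->
    [/\ U x, `|'D_w ('D_v f) u - 'D_w ('D_v f) x| < e
           & `|'D_v ('D_w f) u - 'D_v ('D_w f) x| < e].
  have nU : nbhs u U by exact: open_nbhs_nbhs.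
  have nA : \forall x \near u, `|'D_w ('D_v f) u - 'D_w ('D_v f) x| < e.
    by move/cvgrPdist_lt : c1; apply.
  have nB : \forall x \near u, `|'D_v ('D_w f) u - 'D_v ('D_w f) x| < e.
    by move/cvgrPdist_lt : c2; apply.
  have [r r0 rP] := (@nbhs_normP _ _ u _).1 (filterI (filterI nU nA) nB).
  exists r; first exact: r0.
  by move=> x /rP[[]].
(* h is chosen so small that the whole parallelogram lies in the r-ball. *)
pose k : R := 1 + `|v| + `|w|.
have k0 : 0 < k by rewrite /k -addrA ltr_wpDr// addr_ge0.
pose h : R := r / k.
have h0 : 0 < h by rewrite divr_gt0.
have near_u s t : 0 <= s <= h -> 0 <= t <= h -> `|u - (s *: v + (t *: w + u))| < r.
  move=> /andP[s0 sh] /andP[t0 th].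
  rewrite addrA opprD addrCA subrr addr0 normrN.
  apply: (le_lt_trans (ler_normD _ _)); rewrite !normrZ !ger0_norm//.
  apply: (@le_lt_trans _ _ (h * (`|v| + `|w|))).
    by rewrite mulrDr lerD// ler_wpM2r.
  by rewrite /h mulrAC ltr_pdivrMr// ltr_pM2l// /k -addrA ltrDr.
have [|s [t [sh th E1]]] := @second_difference f u v w h h0.
  by move=> s t sh th; have [/fd[]] := rP _ (near_u _ _ sh th).
have [|t' [s' [th' sh' E2]]] := @second_difference f u w v h h0.
  move=> s' t' sh' th'; rewrite [s' *: w + _]addrCA.
  have [/fd[_ dw _ dwv] _ _] := rP _ (near_u _ _ th' sh').
  by split; [exact: dw|exact: dwv].
have : h ^+ 2 * 'D_w ('D_v f) (s *: v + (t *: w + u)) =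
       h ^+ 2 * 'D_v ('D_w f) (t' *: w + (s' *: v + u)).
  rewrite -[LHS]E1 -[RHS]E2 [h *: w + (h *: v + u)]addrCA.
  by congr (_ + _); exact: addrAC.
have h20 : h ^+ 2 != 0 by rewrite expf_neq0// gt_eqF.
move=> /(mulfI h20); rewrite [t' *: w + _]addrCA.
have [_ + _] := rP _ (near_u _ _ sh th).
have [_ _ +] := rP _ (near_u _ _ sh' th').
move=> Bc Ac E; rewrite -E in Bc.
exists ('D_w ('D_v f) (s *: v + (t *: w + u))); [exact: Ac|exact: Bc].
Qed.
End Schwarz.

(** * Calculus in coordinates *)

Section Partial.
Variable R : realType.
Notation coords := (coords R).
Implicit Types (f g : coords -> R) (u : coords) (U : set coords).

Lemma smooth_differentiable U f u : smooth_on U f -> U u -> differentiable f u.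
Proof. by move=> fs; exact: (fs [::]). Qed.

Lemma smooth_partial U f a : smooth_on U f -> smooth_on U (partial a f).
Proof. by move=> fs s u Uu; have := fs (rcons s a) u Uu; rewrite foldr_rcons. Qed.

Lemma partialC U f a b u : open U -> U u -> smooth_on U f ->
  partial a (partial b f) u = partial b (partial a f) u.
Proof.
move=> Uo Uu fs; rewrite /partial; apply: (derive_symm Uo Uu).
- move=> x Ux; split; apply: diff_derivable.
  + exact: smooth_differentiable Ux.
  + exact: smooth_differentiable Ux.
  + exact: smooth_differentiable (smooth_partial b fs) Ux.
  + exact: smooth_differentiable (smooth_partial a fs) Ux.
- apply: differentiable_continuous.
  exact: smooth_differentiable (smooth_partial a (smooth_partial b fs)) Uu.
- apply: differentiable_continuous.
  exact: smooth_differentiable (smooth_partial b (smooth_partial a fs)) Uu.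
Qed.

(** Bundles differentiability with the values of the partial derivatives, so
    that the rules below compose without side conditions. *)
Definition has_gradient f u (d : 'I_3 -> R) :=
  differentiable f u /\ forall a, partial a f u = d a.

Lemma smooth_gradient U f u : smooth_on U f -> U u ->
  has_gradient f u (fun a => partial a f u).
Proof. by move=> fs Uu; split=> //; exact: smooth_differentiable Uu. Qed.

Lemma gradient_eq f u d d' : has_gradient f u d -> d =1 d' -> has_gradient f u d'.
Proof. by move=> [fd fE] dd; split=> // a; rewrite fE dd. Qed.

Lemma gradient_cst c u : has_gradient (fun=> c) u (fun=> 0).
Proof. by split=> [|a]; [exact: differentiable_cst|exact: derive_cst]. Qed.

Lemma gradientD f g u df dg : has_gradient f u df -> has_gradient g u dg ->
  has_gradient (fun v => f v + g v) u (fun a => df a + dg a).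
Proof.
move=> [fd fE] [gd gE]; split=> [|a]; first exact: differentiableD.
by rewrite -fE -gE; apply: deriveD; exact: diff_derivable.
Qed.

Lemma gradientB f g u df dg : has_gradient f u df -> has_gradient g u dg ->
  has_gradient (fun v => f v - g v) u (fun a => df a - dg a).
Proof.
move=> [fd fE] [gd gE]; split=> [|a]; first exact: differentiableB.
by rewrite -fE -gE; apply: deriveB; exact: diff_derivable.
Qed.

Lemma gradientM f g u df dg : has_gradient f u df -> has_gradient g u dg ->
  has_gradient (fun v => f v * g v) u (fun a => df a * g u + f u * dg a).
Proof.
move=> [fd fE] [gd gE]; split=> [|a]; first exact: differentiableM.
rewrite -fE -gE addrC [_ * g u]mulrC.
by apply: deriveM; exact: diff_derivable.
Qed.

Lemma gradient_sum (f : 'I_3 -> coords -> R) u (df : 'I_3 -> 'I_3 -> R) :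
  (forall e, has_gradient (f e) u (df e)) ->
  has_gradient (fun v => \sum_e f e v) u (fun a => \sum_e df e a).
Proof.
move=> fd; have -> : (fun v => \sum_e f e v) = fun v => f i0 v + f i1 v + f i2 v.
  by apply/funext => v; rewrite sum3.
apply: (gradient_eq (gradientD (gradientD (fd _) (fd _)) (fd _))) => a.
by rewrite sum3.
Qed.

Lemma gradient_near U f g u d : open U -> U u -> (forall v, U v -> f v = g v) ->
  has_gradient g u d -> forall a, partial a f u = d a.
Proof.
move=> Uo Uu fg [_ dE] a; rewrite -dE; apply: near_eq_derive.
have : nbhs u U by exact: open_nbhs_nbhs.
by apply: filterS => v /fg.
Qed.
End Partial.

Section Smooth.
Variable R : realType.

Lemma gradient_coord (k : 'I_3) (u : coords R) :
  has_gradient (fun v => v 0 k) u (fun a => (k == a)%:R).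
Proof.
split=> [|a]; first exact: differentiable_coord.
have idd : derivable (id : coords R -> coords R) u (delta_mx 0 a).
  exact: derivable_id.
have := derive_mx idd; rewrite derive_id => /matrixP /(_ 0 k).
by rewrite /partial !mxE eqxx /= => <-.
Qed.

Lemma gradient_affine (k : 'I_3) (c d : R) (u : coords R) :
  has_gradient (fun v => c + d * v 0 k) u (fun a => d * (k == a)%:R).
Proof.
apply: (gradient_eq (gradientD (gradient_cst c u)
  (gradientM (gradient_cst d u) (gradient_coord k u)))) => a.
by rewrite mul0r !add0r.
Qed.

(** Affine functions of one coordinate are closed under partial derivatives,
    so all their iterated derivatives are differentiable. *)
Lemma smooth_affine U (k : 'I_3) (c d : R) : smooth_on U (fun v => c + d * v 0 k).
Proof.
move=> s u _.
suff [c' [d' ->]] : exists c' d',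
    foldr (@partial R) (fun v => c + d * v 0 k) s = fun v => c' + d' * v 0 k.
  exact: (gradient_affine k c' d' u).1.
elim: s => [|a s [c' [d' IH]]]; first by exists c, d.
exists (d' * (k == a)%:R), 0; rewrite /= IH; apply/funext => v.
by rewrite (gradient_affine k c' d' v).2 mul0r addr0.
Qed.

Lemma smooth_cst U (c : R) : smooth_on U (fun=> c).
Proof.
have -> : (fun=> c) = fun v : coords R => c + 0 * v 0 i0.
  by apply/funext => v; rewrite mul0r addr0.
exact: smooth_affine.
Qed.
End Smooth.

(** * Curvature identities in a chart *)

Section Local.
Variable R : realType.
Variables (U : set (coords R)) (Uo : open U).
Implicit Types (G : coords R -> 'I_3 -> 'I_3 -> 'I_3 -> R) (u : coords R).

Definition symbol_partials G u a b c d : R := partial a (fun v => G v b c d) u.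

Lemma ricci_identity G X u : U u ->
  (forall a b c, smooth_on U (fun v => G v a b c)) ->
  (forall v, U v -> forall a b c, G v a b c = G v c b a) ->
  (forall b, smooth_on U (fun v => X v b)) -> forall a b c,
  cov_mixed G (cov_vector G X) u a b c - cov_mixed G (cov_vector G X) u b a c =
  \sum_d riemann (symbol_partials G u) (G u) a b c d * X u d.
Proof.
move=> Uu Gs GC Xs a b c.
have gradX b' c' := gradientD (smooth_gradient (smooth_partial b' (Xs c')) Uu)
  (gradient_sum (fun d => gradientM (smooth_gradient (Gs b' c' d) Uu)
                                    (smooth_gradient (Xs d) Uu))).
have covE b' c' a' : partial a' (fun v => cov_vector G X v b' c') u = _ :=
  (gradX b' c').2 a'.
rewrite /cov_mixed !covE.
apply: (@ricci_algebra _ (symbol_partials G u) (G u) (X u)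
  (fun a b => partial a (fun v => X v b) u)
  (fun a b c => partial a (partial b (fun v => X v c)) u)).
- exact: GC.
- by move=> a' b' c'; apply: partialC Uo Uu (Xs c').
Qed.

(** On a neighbourhood nabla g = 0 expresses the derivatives of g by the symbols
    and g; its derivative at u, together with the symmetry of the second
    derivatives of g, feeds [metric_algebra]. *)
Lemma metric_skew G (g : coords R -> 'M[R]_3) u : U u ->
  (forall a b c, smooth_on U (fun v => G v a b c)) ->
  (forall a b, smooth_on U (fun v => g v a b)) ->
  (forall v, U v -> forall a b c, cov_metric G g v a b c = 0) ->
  forall a b c d, \sum_e (riemann (symbol_partials G u) (G u) a b e c * g u e d
    + riemann (symbol_partials G u) (G u) a b e d * g u c e) = 0.
Proof.
move=> Uu Gs gs gG.
have dgE v a b c : U v -> partial a (fun v => g v b c) v =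
    \sum_e G v a e b * g v e c + \sum_e G v a e c * g v b e.
  by move=> /gG /(_ a b c) /eqP; rewrite /cov_metric -addrA -opprD subr_eq0 => /eqP.
apply: (@metric_algebra _ (symbol_partials G u) (G u) (fun a b => g u a b)
  (fun a b c d => partial a (partial b (fun v => g v c d)) u)).
- by move=> a b c d; apply: partialC Uo Uu (gs c d).
- move=> a b c d.
  have grad := gradientD
    (gradient_sum (fun e => gradientM (smooth_gradient (Gs b e c) Uu)
                                      (smooth_gradient (gs e d) Uu)))
    (gradient_sum (fun e => gradientM (smooth_gradient (Gs b e d) Uu)
                                      (smooth_gradient (gs c e) Uu))).
  rewrite (gradient_near Uo Uu (fun v Uv => dgE v b c d Uv) grad).
  by congr (_ + _); apply: eq_bigr => e _; rewrite dgE.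
Qed.

Lemma riemann_projective G G' (Y : coords R -> 'I_3 -> R) u
    (dY : 'I_3 -> 'I_3 -> R) : U u ->
  (forall a b c, smooth_on U (fun v => G v a b c)) ->
  (forall b, has_gradient (fun v => Y v b) u (dY^~ b)) ->
  (forall v, U v -> forall a b c, G v a b c = G v c b a) ->
  (forall v, U v -> forall a b c,
     G' v a b c = G v a b c + Y v a * (b == c)%:R + (a == b)%:R * Y v c) ->
  exists P : 'I_3 -> 'I_3 -> R, forall a b c d,
    riemann (symbol_partials G' u) (G' u) a b c d =
    riemann (symbol_partials G u) (G u) a b c d + (a == c)%:R * P b d
    - (b == c)%:R * P a d - (P a b - P b a) * (d == c)%:R.
Proof.
move=> Uu Gs gradY GC G'E.
exists (fun b d => - dY b d + \sum_e Y u e * G u b e d + Y u b * Y u d).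
have dG'E a b c d : symbol_partials G' u a b c d =
    symbol_partials G u a b c d + dY a b * (c == d)%:R + (b == c)%:R * dY a d.
  have grad := gradientD (gradientD (smooth_gradient (Gs b c d) Uu)
    (gradientM (gradY b) (gradient_cst (c == d)%:R u)))
    (gradientM (gradient_cst (b == c)%:R u) (gradY d)).
  rewrite /symbol_partials (gradient_near Uo Uu (fun v Uv => G'E v Uv b c d) grad).
  by rewrite mulr0 addr0 mul0r add0r.
move=> a b c d; rewrite -projective_algebra; last exact: GC.
rewrite /riemann !dG'E; congr (_ + _); apply: eq_bigr => e _.
by rewrite !G'E.
Qed.
End Local.

(** * Metrisable structures *)

Section Global.
Variables (R : realType) (M : manifold3 R).
Implicit Types (N : conn M).

Lemma cod_open (i : chart_ix M) : open (cod i).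
Proof. exact: chart_cod_open. Qed.

Definition cst_field (c : 'I_3) (u : coords R) (b : 'I_3) : R := (c == b)%:R.

Lemma cst_field_smooth (i : chart_ix M) c : vector_field i (cst_field c).
Proof. by move=> b; exact: smooth_cst. Qed.

Lemma cov_cst_field (G : coords R -> 'I_3 -> 'I_3 -> 'I_3 -> R) c u a b :
  cov_vector G (cst_field c) u a b = G u a b c.
Proof.
rewrite /cov_vector (gradient_cst (c == b)%:R u).2 add0r.
rewrite -[RHS](sum_delta c (G u a b)).
by apply: eq_bigr => e _; rewrite mulrC.
Qed.

(** Constant fields turn the relation between covariant derivatives into one
    between symbols. *)
Lemma proj_equiv_symbols N N' : proj_equiv N N' ->
  exists2 Y : comps M ('I_3 -> R), one_form Y &
    forall i u, cod i u -> forall a b c,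
      N' i u a b c = N i u a b c + Y i u a * (b == c)%:R + (a == b)%:R * Y i u c.
Proof.
move=> [Y Yf E]; exists Y => // i u ui a b c.
have := E i _ (@cst_field_smooth i c) u ui a b.
rewrite !cov_cst_field => ->.
congr (_ + _ * _ + _ * _); first by rewrite /cst_field eq_sym.
rewrite -[RHS](sum_delta c (Y i u)).
by apply: eq_bigr => e _; rewrite mulrC.
Qed.

(** Evaluating the Ricci identity on constant fields recovers all components. *)
Lemma curvature_riemann N Rm : is_connection N -> torsion_free N ->
  curvature N Rm -> forall i u, cod i u -> forall a b c d,
  Rm i u a b c d = riemann (symbol_partials (N i) u) (N i u) a b c d.
Proof.
move=> [Ns _] Nt NRm i u ui a b c d.
have := NRm i _ (@cst_field_smooth i d) u ui a b c.
rewrite (ricci_identity (@cod_open i) ui (Ns i) (Nt i) (@cst_field_smooth i d)).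
have E (F : 'I_3 -> R) : \sum_e F e * cst_field d u e = F d.
  by rewrite -[RHS](sum_delta d F); apply: eq_bigr => e _; rewrite mulrC.
by rewrite !E.
Qed.

Lemma riemann_curvature N : is_connection N -> torsion_free N ->
  curvature N (fun i u => riemann (symbol_partials (N i) u) (N i u)).
Proof.
move=> [Ns _] Nt i X Xs u ui a b c.
exact: (ricci_identity (@cod_open i) ui (Ns i) (Nt i) Xs).
Qed.

Lemma metrisable_scalar_vanishes (C : set (conn M)) W eps epsd :
  projective_structure C -> weyl_tensor C W ->
  nonvanishing_trivector eps -> dual_form eps epsd ->
  metrisable C -> vanishes_identically (Sscalar eps epsd W).
Proof.
move=> [N0 [_ _ ->]] [N2 [N2c N2t N02] [Rm NRm RmW]] [_ epsA _ _] epsdA.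
move=> [g [gs gT gU _]] [N1 [_ _ N01] [N1c N1t N1g]] i u ui.
have [Y1 [Y1s _] N1E] := proj_equiv_symbols N01.
have [Y2 [Y2s _] N2E] := proj_equiv_symbols N02.
have Uo := @cod_open i.
(* Both connections are related to N0, hence to each other by Y2 - Y1. *)
have [P1 PE] := @riemann_projective _ _ Uo (N1 i) (N2 i)
  (fun v a => Y2 i v a - Y1 i v a) u _ ui (N1c.1 i)
  (fun a => gradientB (smooth_gradient (Y2s i a) ui) (smooth_gradient (Y1s i a) ui))
  (N1t i)
  (fun v vi a b c => ltac:(rewrite N1E // N2E //; ring)).
have [Wtf [P2 [beta [betaE RW]]]] := RmW i u ui.
apply: (@metric_scalar_vanishes _ (g i u)
  (riemann (symbol_partials (N1 i) u) (N1 i u)) (W i u)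
  (fun a b => P2 a b - P1 a b)) => //.
- exact: gT.
- exact: gU.
- exact: riemann_skew.
- apply: riemann_bianchi; first exact: N1t.
  move=> a b c d; rewrite /symbol_partials.
  have grad := smooth_gradient (N1c.1 i d c b) ui.
  exact: (gradient_near Uo ui (fun v vi => N1t i v vi b c d) grad).
- exact: (metric_skew Uo ui (N1c.1 i) (gs i) (N1g i)).
- move=> a b c d; have := RW a b c d.
  rewrite (curvature_riemann N2c N2t NRm ui) PE betaE => E.
  have -> : W i u a b c d = riemann (symbol_partials (N1 i) u) (N1 i u) a b c d
      + (a == c)%:R * P1 b d - (b == c)%:R * P1 a d - (P1 a b - P1 b a) * (d == c)%:R
      - ((a == c)%:R * P2 b d - (b == c)%:R * P2 a d
         - 2 * ((P2 a b - P2 b a) / 2) * (d == c)%:R).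
    by rewrite E; ring.
  by field.
- exact: epsA.
- exact: (epsdA i u ui).1.
Qed.
End Global.

(** * A projective structure on R^3 with non-zero scalar *)

Section Space.
Variable R : realType.

(** Balls with rational centre and radius 1/(k+1). *)
Lemma rV_second_countable n : @second_countable 'rV[R]_n.
Proof.
pose f (qk : 'rV[rat]_n * nat) : set 'rV[R]_n :=
  ball (map_mx (@ratr R) qk.1 : 'rV[R]_n) (qk.2.+1%:R^-1).
exists (range f).
  exact: card_le_trans (card_image_le _ _) (countableP _).
split=> [_ [[q k] _ <-]|x A /nbhs_ballP[e /= e0 eA]].
  by apply: ball_open; rewrite invr_gt0 ltr0n.
have [k ke] := ltr_add_invr (y := 0) (x := e / 2) ltac:(by rewrite divr_gt0).
rewrite add0r in ke.
have k0 : 0 < k.+1%:R^-1 :> R by rewrite invr_gt0 ltr0n.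
have qP i : exists q : rat, `|ratr q - x 0 i| < k.+1%:R^-1.
  have [q] := @rat_in_itvoo R (x 0 i - k.+1%:R^-1) (x 0 i + k.+1%:R^-1)
    ltac:(by rewrite ltrD2l gtrN).
  by rewrite in_itv /= -ltr_distl => qx; exists q.
pose q : 'rV[rat]_n := \row_i sval (cid (qP i)).
have xq : ball (map_mx (@ratr R) q : 'rV[R]_n) k.+1%:R^-1 x.
  split=> // i j; rewrite !mxE (ord1 i) /ball /=.
  exact: (svalP (cid (qP j))).
exists (f (q, k)).
  split; first by exists (q, k).
  exact: xq.
move=> y qy; apply: eA; rewrite (splitr e).
apply: (@ball_triangle _ _ (map_mx (@ratr R) q : 'rV[R]_n)).
  by apply: (le_ball (ltW ke)); exact: ball_sym.
exact: (le_ball (ltW ke)).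
Qed.

Definition id_chart : chart R (coords R).
Proof.
refine (@Chart R (coords R) setT setT id id openT openT _ _ _ _ _ _) => //.
- by apply: continuous_subspaceT => x; exact: cvg_id.
- by apply: continuous_subspaceT => x; exact: cvg_id.
Defined.

Lemma coord_smooth U k : smooth_on U (fun v : coords R => v 0 k).
Proof.
rewrite (_ : (fun v : coords R => v 0 k) = fun v : coords R => 0 + 1 * v 0 k).
  exact: smooth_affine.
by apply/funext => v; rewrite add0r mul1r.
Qed.

Definition euclidean3 : manifold3 R.
Proof.
refine (@Manifold3 R (coords R) _ _ unit (fun=> id_chart) _ _).
- exact: norm_hausdorff.
- exact: rV_second_countable.
- by move=> x; exists tt.
- by move=> i j a; exact: coord_smooth.
Defined.

Notation E3 := euclidean3.

Lemma euclidean_jac (i j : chart_ix E3) b a : jac i j b a = fun=> (b == a)%:R.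
Proof. by apply/funext => u; exact: (gradient_coord b u).2. Qed.

Definition slope (a b c : 'I_3) : R := ((a == c) && (a == succ3 b))%:R.

(** The summand 0 puts the symbols into the form of [smooth_affine]. *)
Definition example_conn : conn E3 := fun _ u a b c =>
  0 + - slope a b c * u 0 (succ3 a).

Lemma example_torsion_free : torsion_free example_conn.
Proof.
move=> i u _ a b c; rewrite /example_conn /slope.
by have [->|_] := eqVneq a c; rewrite //= !oppr0 !mul0r.
Qed.

Lemma example_is_connection : is_connection example_conn.
Proof.
split=> [i a b c|i j u _ a b c]; first exact: smooth_affine.
rewrite euclidean_jac (gradient_cst _ u).2 addr0.
have -> : \sum_e jac i j c e u * example_conn i u a e b = example_conn i u a c b.
  rewrite -[RHS](sum_delta c (fun e => example_conn i u a e b)).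
  by apply: eq_bigr => e _; rewrite euclidean_jac.
rewrite (bigD1 a) //= (bigD1 b) //= !euclidean_jac !eqxx !mul1r.
rewrite big1 ?addr0 => [|e /negPf eb]; last by rewrite euclidean_jac eb mulr0 mul0r.
rewrite big1 ?addr0 // => d /negPf da; rewrite big1 // => e _.
by rewrite euclidean_jac da !mul0r.
Qed.

Definition example_riemann : comps E3 ('I_3 -> 'I_3 -> 'I_3 -> 'I_3 -> R) :=
  fun i u => riemann (symbol_partials (example_conn i) u) (example_conn i u).

Lemma example_symbol_partials i u a b c d :
  symbol_partials (example_conn i) u a b c d = - slope b c d * (succ3 b == a)%:R.
Proof. exact: (gradient_affine (succ3 b) 0 _ u).2. Qed.

Lemma example_trace_free i u : totally_trace_free (example_riemann i u).
Proof.
have E a b c d : example_riemann i u a b c d =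
    - slope b c d * (succ3 b == a)%:R + slope a c d * (succ3 a == b)%:R
    + u 0 (succ3 a) * u 0 (succ3 b) *
      \sum_e (slope a c e * slope b e d - slope b c e * slope a e d).
  rewrite /example_riemann /riemann !example_symbol_partials !sum3 /example_conn; ring.
move=> p q; split; rewrite sum3 !E !sum3 /slope; move: p q;
 by do 2!elim/ord3_ind; rewrite /=; ring.
Qed.

Definition eps3_comps : comps E3 ('I_3 -> 'I_3 -> 'I_3 -> R) := fun _ _ => eps3 R.

Lemma eps3_alternating : Defs.alternating (eps3 R).
Proof. by do 3!elim/ord3_ind; rewrite /eps3 /= ?opprK ?oppr0. Qed.

Lemma eps3_trivector : nonvanishing_trivector eps3_comps.
Proof.
split=> [i a b c|i u _|i u _|i j u _ a b c].
- exact: smooth_cst.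
- exact: eps3_alternating.
- by exists i0, i1, i2; exact: oner_neq0.
- rewrite /eps3_comps -[LHS](sum_delta a (fun d => eps3 R d b c)).
  apply: eq_bigr => d _; rewrite -(sum_delta b (fun e => eps3 R d e c)) mulr_sumr.
  apply: eq_bigr => e _; rewrite -(sum_delta c (eps3 R d e)) !mulr_sumr.
  by apply: eq_bigr => f _; rewrite !euclidean_jac !mulrA.
Qed.

Lemma eps3_dual : dual_form eps3_comps eps3_comps.
Proof.
move=> i u _; split; first exact: eps3_alternating.
by rewrite /eps3_comps !sum3 /eps3 /=; ring.
Qed.

Lemma example_scalar : Sscalar eps3_comps eps3_comps example_riemann tt 0 = 24.
Proof.
have VE a b c : Vtensor eps3_comps example_riemann tt 0 a b c =
    2 * ((a == b) && (c == succ3 a))%:R.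
  have R0 d e p q : example_riemann tt 0 d e p q =
      - slope e p q * (succ3 e == d)%:R + slope d p q * (succ3 d == e)%:R.
    rewrite /example_riemann /riemann !example_symbol_partials big1 => [|x _].
      by ring.
    by rewrite /example_conn !mxE !mulr0 addr0 mul0r subr0.
  rewrite /Vtensor /eps3_comps.
  under eq_bigr => d _ do under eq_bigr => e _ do rewrite R0.
  rewrite !sum3 /slope.
  by move: a b c; do 3!elim/ord3_ind; rewrite /eps3 /=; ring.
rewrite -[LHS]/(cubic (Vtensor eps3_comps example_riemann tt 0)) cubic_trace.
by rewrite !sum3 !VE /=; ring.
Qed.

Lemma example_nonmetrisable :
  exists (C : set (conn E3))
          (W : comps E3 ('I_3 -> 'I_3 -> 'I_3 -> 'I_3 -> R))
          (eps epsd : comps E3 ('I_3 -> 'I_3 -> 'I_3 -> R)),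
     [/\ projective_structure C, weyl_tensor C W,
         nonvanishing_trivector eps, dual_form eps epsd &
         ~ vanishes_identically (Sscalar eps epsd W)].
Proof.
have Nc := example_is_connection; have Nt := example_torsion_free.
exists [set N | [/\ is_connection N, torsion_free N & proj_equiv example_conn N]].
exists example_riemann, eps3_comps, eps3_comps; split.
- by exists example_conn.
- exists example_conn; first split => //.
    exists (fun _ _ _ => 0).
      split=> [i a|i j u _ a]; first exact: smooth_cst.
      by rewrite big1 // => b _; rewrite mulr0.
    move=> i X _ u _ a b; rewrite mul0r addr0 big1 ?mulr0 ?addr0 // => c _.
    by rewrite mul0r.
  (* The curvature is trace-free, so it is its own Weyl part with P = 0. *)
  exists example_riemann; first exact: riemann_curvature.
  move=> i u _; split; first exact: example_trace_free.
  exists (fun _ _ => 0), (fun _ _ => 0); split=> [a b|a b c d].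
    by rewrite subrr mul0r mulr0.
  by rewrite !(mulr0,mul0r,addr0,subr0).
- exact: eps3_trivector.
- exact: eps3_dual.
- move=> /(_ tt 0 I); rewrite example_scalar => /eqP.
  by rewrite pnatr_eq0.
Qed.
End Space.

Theorem theorem1p4 (R : realType) :
  (forall (M : manifold3 R) (C : set (conn M))
          (W : comps M ('I_3 -> 'I_3 -> 'I_3 -> 'I_3 -> R))
          (eps epsd : comps M ('I_3 -> 'I_3 -> 'I_3 -> R)),
     projective_structure C -> weyl_tensor C W ->
     nonvanishing_trivector eps -> dual_form eps epsd ->
     metrisable C -> vanishes_identically (Sscalar eps epsd W)) /\
  (exists (M : manifold3 R) (C : set (conn M))
          (W : comps M ('I_3 -> 'I_3 -> 'I_3 -> 'I_3 -> R))
          (eps epsd : comps M ('I_3 -> 'I_3 -> 'I_3 -> R)),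
     [/\ projective_structure C, weyl_tensor C W,
         nonvanishing_trivector eps, dual_form eps epsd &
         ~ vanishes_identically (Sscalar eps epsd W)]).
Proof.
split; last by exists (euclidean3 R); exact: example_nonmetrisable.
by move=> M C W eps epsd; exact: metrisable_scalar_vanishes.
Qed.
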